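(* Under the AOA-gs sampling rule, the best alternative eventually always belongs to the estimated good enough subset: almost surely there exists $t_0$ such that $\langle 1\rangle\in\widehat{\mathcal F}_t^m$ for all $t\ge t_0$.
   Context: There are $k\ge2$ alternatives and an integer $1\le m<k$. Alternative $h$ produces i.i.d. samples $X_{h,1},X_{h,2},\dots\sim N(\mu_h,\sigma_h^2)$, independent across alternatives, with $\sigma_h>0$ known and the true means $\mu_1,\dots,\mu_k$ pairwise distinct; $\langle 1\rangle$ is the index of the largest true mean. Independent conjugate priors $\mu_h\sim N(\mu_h^{(0)},(\sigma_h^{(0)})^2)$ are used. If after $t$ total samples alternative $h$ has received $t_h$ samples with sample mean $m_h^{(t)}$, its posterior is $N(\mu_h^{(t)},(\sigma_h^{(t)})^2)$ with $(\sigma_h^{(t)})^2=\big(1/(\sigma_h^{(0)})^2+t_h/\sigma_h^2\big)^{-1}$ and $\mu_h^{(t)}=(\sigma_h^{(t)})^2\big(\mu_h^{(0)}/(\sigma_h^{(0)})^2+t_h m_h^{(t)}/\sigma_h^2\big)$. Let $\langle 1\rangle_t,\dots,\langle k\rangle_t$ order the alternatives by decreasing posterior mean, $\widehat{\mathcal F}_t^m=\{\langle1\rangle_t,\dots,\langle m\rangle_t\}$ and $\widehat{\mathcal F}_t^{k-m}=\{\langle m+1\rangle_t,\dots,\langle k\rangle_t\}$. AOA-gs rule: after an initial stage giving each alternative $n_0\ge1$ samples, at each step $t$ and for each candidate $a\in\{1,\dots,k\}$ set $s_h^2(a)=(\sigma_h^{(t)})^2$ for $h\ne a$ and $s_a^2(a)=\big(1/(\sigma_a^{(0)})^2+(t_a+1)/\sigma_a^2\big)^{-1}$,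 and compute $$\widehat V_t(a)=\max_{i\in\widehat{\mathcal F}_t^m}\ \min_{j\in\widehat{\mathcal F}_t^{k-m}}\frac{(\mu_i^{(t)}-\mu_j^{(t)})^2}{s_i^2(a)+s_j^2(a)};$$ the next sample is drawn (from the true distribution) for an alternative $a$ maximizing $\widehat V_t(a)$. *)

(* Defs.v *)
From HB Require Import structures.
From mathcomp Require Import all_boot all_order all_algebra.
From mathcomp Require Import all_classical all_reals all_analysis.
Set Implicit Arguments. Unset Strict Implicit. Unset Printing Implicit Defensive.
Import Order.TTheory GRing.Theory Num.Theory.
Local Open Scope classical_set_scope.
Local Open Scope ring_scope.

Definition mutually_independent d (T : measurableType d) (R : realType)
    (P : probability T R) (I : eqType) (X : I -> T -> R) : Prop :=
  forall (J : seq I) (B : I -> set R), uniq J ->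
    (forall i, measurable (B i)) ->
    P [set w | forall i, i \in J -> B i (X i w)] =
    (\prod_(i <- J) P (X i @^-1` B i))%E.

Section AOA.
Variables (R : realType) (k : nat).
Variables (mu0 sig sig0 : 'I_k -> R).

Definition post_var (h : 'I_k) (n : nat) : R :=
  ((sig0 h ^+ 2)^-1 + n%:R / sig h ^+ 2)^-1.

(** Posterior mean of h, given counts c (t_h = c h) and sample sums S
    (S h = t_h * m_h^{(t)}). *)
Definition post_mean (c : 'I_k -> nat) (S : 'I_k -> R) (h : 'I_k) : R :=
  post_var h (c h) * (mu0 h / sig0 h ^+ 2 + S h / sig h ^+ 2).

Definition in_top (m : nat) (M : 'I_k -> R) (h : 'I_k) : bool :=
  ltn #|[pred j : 'I_k | (M h < M j) || ((M j == M h) && ltn j h)]| m.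

Definition s2 (c : 'I_k -> nat) (a h : 'I_k) : R :=
  post_var h (c h + (h == a))%N.

(** \hat V_t(a) (as an extended real; the index sets are nonempty when
    1 <= m < k, so the value is in fact finite). *)
Definition Vhat (m : nat) (c : 'I_k -> nat) (S : 'I_k -> R) (a : 'I_k)
  : \bar R :=
  let M := post_mean c S in
  \big[maxe/-oo%E]_(i | in_top m M i)
     \big[mine/+oo%E]_(j | ~~ in_top m M j)
        ((M i - M j) ^+ 2 / (s2 c a i + s2 c a j))%:E.

(** Sample sums: S h = sum of the first c h samples of alternative h
    (x h i is the (i+1)-th sample drawn from alternative h). *)
Definition sums (x : 'I_k -> nat -> R) (c : 'I_k -> nat) (h : 'I_k) : R :=
  \sum_(i < c h) x h i.

(** Sample counts after the initial stage (n0 each) followed by s AOA-gs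
    steps; pick s c S is the alternative chosen at step s in state (c, S). *)
Fixpoint counts (n0 : nat) (pick : nat -> ('I_k -> nat) -> ('I_k -> R) -> 'I_k)
    (x : 'I_k -> nat -> R) (s : nat) : 'I_k -> nat :=
  match s with
  | 0 => fun _ => n0
  | s'.+1 =>
      let c := counts n0 pick x s' in
      let a := pick s' c (sums x c) in
      fun h => (c h + (h == a))%N
  end.

End AOA.

(* Main.v *)
(** On almost every sample path the posterior mean of an alternative sampled
    infinitely often (i.o.) tends to its true mean and its posterior variance to
    0, while the other alternatives freeze.  Almost surely all limiting means
    are distinct (a frozen posterior mean is an affine function, with nonzero
    slope, of an atomless sample independent of everything it is compared with),
    so the estimated ranking stabilises.  If the limiting top set excluded the
    best alternative, the limiting value of \hat V would be finite: a top i.o.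
    alternative paired with an i.o. best one would have to be ranked below it.
    Let i attain the maximum over the top set.  If i is frozen, sampling i once
    more increases the limiting value; if i is i.o., then, ties being excluded,
    its minimising opponent is unique and frozen, and sampling that opponent
    increases the value.  Sampling an i.o. alternative leaves the limiting value
    unchanged, so the rule must eventually prefer a frozen alternative, a
    contradiction.  The strong law is obtained from the Gaussian moment
    generating function, Chernoff's bound and Borel-Cantelli. *)

Require Import Defs.
From HB Require Import structures.
From mathcomp Require Import all_boot all_order all_algebra.
From mathcomp Require Import all_classical all_reals all_analysis measurable_realfun.
From mathcomp Require Import ring lra.
Import Order.TTheory GRing.Theory Num.Theory.
Import numFieldNormedType.Exports.
Set SsrOldRewriteGoalsOrder.
Set Implicit Arguments. Unset Strict Implicit. Unset Printing Implicit Defensive.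
Local Open Scope classical_set_scope.
Local Open Scope ring_scope.

(** * Independence *)

Section independence.
Context d (T : measurableType d) (R : realType) (P : probability T R).

(** A π-system generating the σ-algebra of the coordinates in [J]. Measurability for that σ-algebra
    expresses that a variable depends on these coordinates only. *)
Definition cylinders (I : choiceType) (X : I -> T -> R) (J : seq I) : set (set T) :=
  [set E | exists2 B : I -> set R, (forall i, measurable (B i)) &
     E = [set w | forall i, i \in J -> B i (X i w)]].

Lemma measurable_cylinder_coord (I : choiceType) (X : I -> T -> R) (J : seq I) i :
  i \in J ->
  measurable_fun [set: g_sigma_algebraType (cylinders X J)] (X i).
Proof.
move=> iJ _ B mB; rewrite setTI; apply: sub_sigma_algebra.
exists (fun j => if j == i then B else setT).
  by move=> j; case: eqP.
apply/seteqP; split => w /=; first by move=> Bw j jJ; case: eqP => [->|].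
by move=> /(_ i iJ); rewrite eqxx.
Qed.

Lemma cylinders_measurable (I : choiceType) (X : I -> T -> R) (J : seq I) :
  (forall i, measurable_fun setT (X i)) -> cylinders X J `<=` measurable.
Proof.
move=> mX _ [C mC ->].
rewrite [X in measurable X](_ : _ = \big[setI/setT]_(i <- J) (X i @^-1` C i)).
  by apply: bigsetI_measurable => i _; rewrite -[X in measurable X]setTI; exact: mX.
by rewrite -bigcap_seq.
Qed.

Lemma independent_from_rest (I : choiceType) (X : I -> T -> R) (J : seq I) (p : I) :
  (forall i, measurable_fun setT (X i)) ->
  mutually_independent P X -> uniq J -> p \notin J ->
  forall Y : T -> R,
  measurable_fun [set: g_sigma_algebraType (cylinders X J)] Y ->
  forall A B, measurable A -> measurable B ->
  P (X p @^-1` A `&` Y @^-1` B) = (P (X p @^-1` A) * P (Y @^-1` B))%E.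
Proof.
move=> mX indX uJ pJ Y mY A B mA mB.
have mE i C : measurable C -> measurable (X i @^-1` C).
  by move=> mC; rewrite -[X in measurable X]setTI; exact: mX.
have cylm := @cylinders_measurable _ _ J mX.
have pA : (P (X p @^-1` A) = (fine (P (X p @^-1` A)))%:E)%E.
  by rewrite fineK// fin_num_measure//; exact: mE.
have f0 : 0 <= fine (P (X p @^-1` A)) by rewrite fine_ge0.
(* [m1] sends E to P(E ∩ {X p ∈ A}), and [m2] sends E to P(X p ∈ A) P(E). *)
pose m1 : {measure set T -> \bar R} := mrestr P (mE p A mA).
pose m2 : {measure set T -> \bar R} := mscale (NngNum f0) P.
suff: m1 (Y @^-1` B) = m2 (Y @^-1` B).
  by rewrite /m1 /m2/= /mrestr/= /mscale/= setIC pA.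
apply: (@g_sigma_algebra_measure_unique _ _ _ (cylinders X J) cylm (fun=> setT)) => //.
- move=> _; exists (fun=> setT) => //.
  by apply/seteqP; split.
- by rewrite bigcup_const.
- move=> _ _ [C mC ->] [D mD ->]; exists (fun i => C i `&` D i).
    by move=> i; exact: measurableI.
  by apply/seteqP; split=> w /=; [move=> [H K] i iJ; split; auto|
    move=> H; split=> i /H[]].
- move=> _ [C mC ->]; rewrite /m1 /m2/= /mrestr/= /mscale/=.
  (* Inserting [A] at coordinate [p] turns the intersection into one cylinder over [p :: J], to
     which mutual independence applies. *)
  pose D i := if i == p then A else C i.
  have mD i : measurable (D i) by rewrite /D; case: eqP.
  have DC i : i \in J -> D i = C i.
    by move=> iJ; rewrite /D; case: eqP => // ip; rewrite -ip iJ in pJ.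
  have := indX (p :: J) D; rewrite /= pJ uJ => /(_ isT mD).
  rewrite big_cons {2}/D eqxx -pA (indX J C uJ mC).
  rewrite [in X in _ = (_ * X)%E -> _]big_seq.
  under [in X in _ = (_ * X)%E -> _]eq_bigr => i /DC -> do over.
  rewrite -big_seq => <-; congr (P _); apply/seteqP; split => w /=.
    move=> [H K] i; rewrite inE => /orP[/eqP->|iJ].
      by rewrite /D eqxx.
    by rewrite DC//; exact: H.
  move=> H; split; last by have := H p; rewrite inE eqxx /D eqxx; exact.
  by move=> i iJ; rewrite -DC//; apply: H; rewrite inE iJ orbT.
- move=> _; rewrite /m1/= /mrestr/=.
  by rewrite (le_lt_trans (probability_le1 _ _)) ?ltry// setTI; exact: (mE _ _ mA).
- by have := mY measurableT B mB; rewrite setTI.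
Qed.

(** The law of the pair agrees with the product measure on rectangles, hence everywhere; Tonelli
    then gives the iterated integral. *)
Lemma ge0_integral_independent d1 d2 (T1 : measurableType d1)
    (T2 : measurableType d2) (X : {RV P >-> T1}) (Y : {RV P >-> T2})
    (f : T1 * T2 -> \bar R) :
  (forall A B, measurable A -> measurable B ->
    P (X @^-1` A `&` Y @^-1` B) = (P (X @^-1` A) * P (Y @^-1` B))%E) ->
  measurable_fun setT f -> (forall z, (0 <= f z)%E) ->
  (\int[P]_w f (X w, Y w) =
   \int[distribution P Y]_y \int[distribution P X]_x f (x, y))%E.
Proof.
move=> indXY mf f0.
have mXY : measurable_fun setT (fun w => (X w, Y w)).
  exact: measurable_fun_pair.
have := @ge0_integral_pushforward _ _ _ _ R _ mXY P setT f measurableT mf.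
move=> /(_ (fun z _ => f0 z)); rewrite preimage_setT => <-.
rewrite -(fubini_tonelli2 f)//=.
apply: eq_measure_integral => A mA _; apply/esym.
apply: (@product_measure_unique _ _ _ _ R (distribution P X) (distribution P Y)
  (pushforward P (fun w => (X w, Y w)))) => //.
Qed.

End independence.

(** * Normal samples *)

(** The Radon-Nikodym derivative of the normal law has the same integrals as [normal_pdf] on all
    measurable sets, so the two coincide almost everywhere. *)
Lemma ge0_integral_normal_prob (R : realType) (m s : R)
    (f : measurableTypeR R -> \bar R) :
  measurable_fun setT f -> (forall x, (0 <= f x)%E) ->
  (\int[normal_prob m s]_x f x =
   \int[lebesgue_measure]_x (f x * (normal_pdf m s x)%:E))%E.
Proof.
move=> mf f0; have dom := normal_prob_dominates m s.
rewrite -(Radon_Nikodym_SigmaFinite.change_of_variables dom f0)//.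
have intg := Radon_Nikodym_SigmaFinite.f_integrable dom.
have mpdf : measurable_fun setT (fun x : measurableTypeR R => (normal_pdf m s x)%:E).
  by apply/measurable_EFinP; exact: measurable_normal_pdf.
apply: ge0_ae_eq_integral => //.
- by apply: emeasurable_funM => //; exact: measurable_int intg.
- exact: emeasurable_funM.
- by move=> x _; rewrite mule_ge0// Radon_Nikodym_SigmaFinite.f_ge0.
- by move=> x _; rewrite mule_ge0// lee_fin normal_pdf_ge0.
apply: ae_eqe_mul2l; apply: integral_ae_eq => //.
by move=> E _ mE; rewrite -Radon_Nikodym_SigmaFinite.f_integral.
Qed.

Lemma normal_prob_mgf (R : realType) (m s l : R) : s != 0 ->
  (\int[normal_prob m s]_x (expR (l * (x - m)))%:E =
   (expR (l ^+ 2 * s ^+ 2 / 2))%:E)%E.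
Proof.
move=> s0; rewrite ge0_integral_normal_prob//; last first.
  apply/measurable_EFinP; apply: measurableT_comp => //.
  by apply: measurable_funM => //; exact: measurable_funB.
(* completing the square *)
have sq x : expR (l * (x - m)) * normal_pdf m s x =
    expR (l ^+ 2 * s ^+ 2 / 2) * normal_pdf (m + l * s ^+ 2) s x.
  rewrite !normal_pdfE// mulrCA [RHS]mulrCA; congr (_ * _).
  rewrite /normal_fun -!expRD; congr expR.
  by field.
under eq_integral => x _ do rewrite -EFinM sq EFinM.
rewrite ge0_integralZl_EFin ?expR_ge0//.
- by rewrite integral_normal_pdf mule1.
- by move=> x _; rewrite lee_fin normal_pdf_ge0.
- by apply/measurable_EFinP; exact: measurable_normal_pdf.
Qed.

Lemma normal_prob_set1 (R : realType) (m s y : R) : normal_prob m s [set y] = 0%E.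
Proof.
have /null_content_dominatesP := normal_prob_dominates m s.
by apply => //; exact: lebesgue_measure_set1.
Qed.

Section normal_samples.
Context d (T : measurableType d) (R : realType) (P : probability T R).
Context (I : choiceType) (X : I -> T -> R).
Hypothesis mX : forall i, measurable_fun setT (X i).
Hypothesis indX : mutually_independent P X.

Lemma measurable_fun_cylinders J (Y : T -> R) :
  measurable_fun [set: g_sigma_algebraType (cylinders X J)] Y ->
  measurable_fun [set: T] Y.
Proof.
move=> mY _ B mB; rewrite setTI; have := mY measurableT B mB; rewrite setTI.
apply: smallest_sub; first exact: sigma_algebra_measurable.
exact: (cylinders_measurable mX).
Qed.

(** With [Y] independent of [X p], the probability of equality is the product measure of the
    diagonal, whose sections are singletons and so null for a normal law. *)
Lemma normal_neq_independent (p : I) (J : seq I) (m s : R) (Y : T -> R) :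
  uniq J -> p \notin J ->
  (forall B, measurable B -> P (X p @^-1` B) = normal_prob m s B) ->
  measurable_fun [set: g_sigma_algebraType (cylinders X J)] Y ->
  {ae P, forall w, X p w != Y w}.
Proof.
move=> uJ pJ lawX mY.
have mY' := measurable_fun_cylinders mY.
pose X' : {RV P >-> R} := mfun_Sub (mem_set (mX p)).
pose Y' : {RV P >-> R} := mfun_Sub (mem_set mY').
pose D : set (R * R) := [set z | z.1 - z.2 = 0].
have mD : measurable D.
  have mf : measurable_fun setT (fun z : R * R => z.1 - z.2).
    exact: measurable_funB.
  by have := mf measurableT [set 0] (measurable_set1 0); rewrite setTI.
have indXY := independent_from_rest mX indX uJ pJ mY.
have mfD : measurable_fun setT (fun z : R * R => (\1_D z)%:E : \bar R).
  by apply/measurable_EFinP; exact: measurable_indic.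
have := @ge0_integral_independent _ _ _ P _ _ _ _ X' Y' _ indXY mfD.
rewrite [X in _ -> _ = X]integral0_eq; last first.
  move=> y _.
  rewrite (_ : (fun x => _) = (fun x => (\1_[set y] x)%:E)); last first.
    by apply/funext => x; rewrite !indicE; congr (((nat_of_bool _)%:R)%:E);
      apply/idP/idP => /set_mem; rewrite /D/= => H; apply/mem_set => /=;
      [lra|rewrite H subrr].
  rewrite integral_indic// setIT.
  have := lawX [set y] (measurable_set1 y); rewrite normal_prob_set1.
  exact.
pose E := [set w | X p w - Y w = 0].
have mE : measurable E.
  have mf : measurable_fun setT (fun w => X p w - Y w) by exact: measurable_funB.
  by have := mf measurableT [set 0] (measurable_set1 0); rewrite setTI.
rewrite (_ : (fun w => _) = (fun w => (\1_E w)%:E))//.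
rewrite integral_indic// setIT => PE.
exists E; split => //; first by apply: PE => z; rewrite lee_fin.
move=> w /= /negP; rewrite negbK /E/= => /eqP ->; exact: subrr.
Qed.

End normal_samples.

(** * Strong law of large numbers for normal samples *)

Section strong_law.
Context d (T : measurableType d) (R : realType) (P : probability T R).
Context (I : choiceType) (X : I -> T -> R).
Hypothesis mX : forall i, measurable_fun setT (X i).
Hypothesis indX : mutually_independent P X.
Variables (g : nat -> I) (m s : R).
Hypothesis g_inj : injective g.
Hypothesis s_gt0 : 0 < s.
Hypothesis lawX : forall n B, measurable B ->
  P (X (g n) @^-1` B) = normal_prob m s B.

Let S n w := \sum_(i < n) (X (g i) w - m).

Let mS n : measurable_fun setT (S n).
Proof. by apply: measurable_sum => i; exact: measurable_funB. Qed.

(** Induction on [n]: the last sample is independent of the partial sum before it, so the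
    exponential moments multiply. *)
Lemma mgf_sum n l :
  (\int[P]_w (expR (l * S n w))%:E = (expR (l ^+ 2 * s ^+ 2 / 2 *+ n))%:E)%E.
Proof.
elim: n => [|n IHn].
  rewrite mulr0n expR0 (eq_integral (cst 1%E)).
    by rewrite integral_cst// mul1e; exact: probability_setT.
  by move=> w _; rewrite /S big_ord0 mulr0 expR0.
pose J := [seq g i | i <- iota 0 n].
have uJ : uniq J by rewrite map_inj_uniq// iota_uniq.
have gJ : g n \notin J by rewrite mem_map// mem_iota ltnn.
pose X' : {RV P >-> measurableTypeR R} :=
  @mfun_Sub _ _ T (measurableTypeR R) (X (g n)) (mem_set (mX (g n))).
pose S' : {RV P >-> measurableTypeR R} :=
  @mfun_Sub _ _ T (measurableTypeR R) (S n) (mem_set (mS n)).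
have mS' : measurable_fun [set: g_sigma_algebraType (cylinders X J)] (S n).
  apply: measurable_sum => i; apply: measurable_funB => //.
  by apply: measurable_cylinder_coord; rewrite map_f// mem_iota/=.
have indXS := independent_from_rest mX indX uJ gJ mS'.
pose f (z : measurableTypeR R * measurableTypeR R) : \bar R := (expR (l * (z.1 - m)) * expR (l * z.2))%:E.
have mexp (c : R) : measurable_fun setT (fun x : measurableTypeR R => expR (l * (x - c))).
  apply: measurableT_comp => //.
  by apply: measurable_funM => //; exact: measurable_funB.
have mf : measurable_fun setT f.
  apply/measurable_EFinP; apply: measurable_funM.
    exact: (measurableT_comp (mexp m) measurable_fst).
  have := measurableT_comp (mexp 0) (@measurable_snd _ _ (measurableTypeR R) (measurableTypeR R)).
  by apply: eq_measurable_fun => z _ /=; rewrite subr0.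
have f0 z : (0 <= f z)%E by rewrite lee_fin mulr_ge0 ?expR_ge0.
have := @ge0_integral_independent _ _ _ P _ _ _ _ X' S' f indXS mf f0.
rewrite (_ : (fun w => f (X' w, S' w)) =
             (fun w => (expR (l * S n.+1 w))%:E)); last first.
  apply/funext => w; transitivity
      (expR (l * (X (g n) w - m)) * expR (l * S n w))%:E => //.
  by rewrite /S big_ord_recr/= -expRD -mulrDr (addrC (_ - m)).
move=> ->.
have inner : (\int[distribution P X']_x (expR (l * (x - m)))%:E =
    (expR (l ^+ 2 * s ^+ 2 / 2))%:E)%E.
  rewrite -(normal_prob_mgf m l (lt0r_neq0 s_gt0)).
  apply: eq_measure_integral => A mA _; exact: lawX.
under eq_integral => y _.
  under eq_integral do rewrite /f/= mulrC EFinM.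
  rewrite ge0_integralZl_EFin ?expR_ge0//; last first.
    by apply/measurable_EFinP; exact: mexp.
  rewrite inner.
  over.
have mexp0 : measurable_fun setT (fun y : measurableTypeR R => (expR (l * y))%:E).
  apply/measurable_EFinP.
  by have := mexp 0; apply: eq_measurable_fun => y _; rewrite subr0.
rewrite /= ge0_integralZr//.
rewrite ge0_integral_distribution//.
by rewrite /= IHn -EFinM -expRD -mulrSr.
Qed.

(** The sign [b] is 1 or -1, which treats both tails at once. Chernoff's bound is geometric in [n],
    hence summable, and Borel-Cantelli applies. *)
Lemma deviation_ae (b e : R) : b ^+ 2 = 1 -> 0 < e ->
  {ae P, forall w, \forall n \near \oo, b * S n w < n%:R * e}.
Proof.
move=> b1 e0.
pose c := e ^+ 2 / (2 * s ^+ 2).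
have c0 : 0 < c by rewrite divr_gt0 ?mulr_gt0 ?exprn_gt0.
pose F n := [set w | n%:R * e <= b * S n w].
have mbS n : measurable_fun setT (fun w => b * S n w) by exact: measurable_funM.
have mF n : measurable (F n).
  have := mbS n measurableT `[n%:R * e, +oo[%classic (measurable_itv _).
  rewrite setTI; congr measurable; apply/seteqP.
  by split => w; rewrite /F/= in_itv/= andbT.
have PF n : (P (F n) <= (geometric 1 (expR (- c)) n)%:E)%E.
  pose Z : {RV P >-> R} := mfun_Sub (mem_set (mbS n)).
  (* The parameter [e / s ^+ 2] minimises l^2 s^2 / 2 - l e, with minimum [- c]. *)
  have l0 : 0 < e / s ^+ 2 by rewrite divr_gt0 ?exprn_gt0.
  have := chernoff Z (n%:R * e) l0.
  move=> /le_trans; apply; rewrite /mmt_gen_fun unlock.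
  rewrite (_ : (\int[P]_w _)%E =
      (\int[P]_w (expR (e / s ^+ 2 * b * S n w))%:E)%E); last first.
    by apply: eq_integral => w _; congr (expR _)%:E; rewrite /=; ring.
  rewrite mgf_sum -EFinM lee_fin -expRD /geometric/= mul1r -expRM_natl ler_expR.
  rewrite exprMn b1 mulr1 /c -mulr_natr le_eqVlt; apply/orP; left; apply/eqP.
  by field; rewrite gt_eqF.
have sumPF : (\sum_(n <oo) P (F n) < +oo)%E.
  apply: (@le_lt_trans _ _ (\sum_(n <oo) (geometric 1 (expR (- c)) n)%:E)%E).
    exact: lee_nneseries.
  have r1 : `|expR (- c)| < 1 by rewrite ger0_norm ?expR_ge0// expR_lt1 oppr_lt0.
  have cvgr : eseries (EFin \o geometric 1 (expR (- c))) @ \oo -->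
      (1 * (1 - expR (- c))^-1)%:E.
    rewrite [X in X @ _ --> _](_ : _ = EFin \o series (geometric 1 (expR (- c)))).
      by apply: cvg_EFin; [exact: nearW|exact: cvg_geometric_series].
    by apply/funext => x; rewrite /= /eseries/= sumEFin.
  by rewrite (_ : limn _ = (1 * (1 - expR (- c))^-1)%:E) ?ltry//; exact/cvg_lim.
have := lim_sup_set_cvg0 mF sumPF.
exists (lim_sup_set F); split => //.
  by apply: bigcapT_measurable => n; exact: bigcup_measurable.
move=> w /= nw n _; apply: contrapT => nF; apply: nw.
exists n => // j /= nj; rewrite ltNge; apply/negP => Fj; apply: nF.
by exists j.
Qed.

(** Only countably many tolerances 1/(p+1) and the two signs are used, so the exceptional null sets
    can be united. *)
Lemma strong_law_normal :
  {ae P, forall w, (fun n => (\sum_(i < n) X (g i) w) / n%:R) @ \oo --> m}.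
Proof.
have dev p (b : R) : b ^+ 2 = 1 ->
    {ae P, forall w, \forall n \near \oo, b * S n w < n%:R * p.+1%:R^-1}.
  by move=> b1; apply: deviation_ae.
have /ae_foralln up := fun p => dev p 1 (expr1n _ _).
have /ae_foralln lo := fun p => dev p (- 1) (sqrr_sign _ 1).
apply: filterS2 up lo => w up lo.
apply/cvgrPdist_lt => e e0.
have [p _ /(_ p (leqnn p)) pe] := near_infty_natSinv_lt (PosNum e0).
near=> n.
have n0 : 0 < n%:R :> R by rewrite ltr0n; near: n; exact: nbhs_infty_gt.
have SE : (\sum_(i < n) X (g i) w) / n%:R = S n w / n%:R + m.
  by rewrite /S sumrB sumr_const card_ord -mulr_natr; field; rewrite gt_eqF.
rewrite SE distrC addrK; apply: lt_trans pe.
rewrite normrM normfV (gtr0_norm n0) ltr_pdivrMr// (mulrC _ n%:R) ltr_norml.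
have : 1 * S n w < n%:R * p.+1%:R^-1 by near: n; exact: up.
have : - 1 * S n w < n%:R * p.+1%:R^-1 by near: n; exact: lo.
rewrite mulN1r mul1r ltrNl => -> ->.
Unshelve. all: by end_near. Qed.

End strong_law.

(** * Behaviour of the rule along a sample path *)

(* [io] is the set of alternatives sampled infinitely often, [L] and [W] are the
   limiting means and variances, [W' h] the variance of [h] after one more
   sample.  The ratios are inverted, [r i j = (W i + W j) / (L i - L j)^2], so
   that a pair with vanishing variances gives 0 instead of +oo. *)
Lemma improving_candidate (R : realFieldType) (I : finType) (F io : pred I)
    (L W W' : I -> R) (i0 j0 : I) :
  F i0 -> ~~ F j0 ->
  (forall h, io h -> W h = 0) ->
  (forall h, ~~ io h -> 0 <= W' h < W h) ->
  (forall h, 0 <= W h) ->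
  (forall i j, F i -> ~~ F j -> L i != L j) ->
  (forall i, F i -> exists2 j, ~~ F j & 0 < W i + W j) ->
  (forall i j j', F i -> ~~ F j -> ~~ F j' -> io i -> ~~ io j -> ~~ io j' ->
     j != j' -> W j / (L i - L j) ^+ 2 != W j' / (L i - L j') ^+ 2) ->
  exists b q, let Wb h := if h == b then W' h else W h in
    [/\ ~~ io b, 0 < q,
     forall i, F i -> exists2 j, ~~ F j & q * (L i - L j) ^+ 2 < W i + W j &
     exists2 i, F i &
       forall j, ~~ F j -> Wb i + Wb j < q * (L i - L j) ^+ 2].
Proof.
move=> Fi0 Fj0 Wio WW' W0 Lneq Wpos notie.
have dpos i j : F i -> ~~ F j -> 0 < (L i - L j) ^+ 2.
  by move=> Fi Fj; rewrite exprn_even_gt0//= subr_eq0 Lneq.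
have neqF i j : F i -> ~~ F j -> (j == i) = false.
  by move=> Fi Fj; apply: contraNF Fj => /eqP ->.
pose r i j := (W i + W j) / (L i - L j) ^+ 2.
pose jm i := [arg max_(j > j0 | ~~ F j) r i j]%O.
(* Inversion swaps the extrema: [jm i] is the opponent minimising the original ratio, [im] attains
   the outer maximum, and [rho] is the inverse of the limiting value. *)
have Fjm i : ~~ F (jm i) by rewrite /jm; case: arg_maxP.
have jmP i j : ~~ F j -> r i j <= r i (jm i).
  by rewrite /jm; case: arg_maxP => // j' _ + Fj; exact.
pose im := [arg min_(i < i0 | F i) r i (jm i)]%O.
have Fim : F im by rewrite /im; case: arg_minP.
have imP i : F i -> r im (jm im) <= r i (jm i).
  by rewrite /im; case: arg_minP => // i' _ + Fi; exact.
set rho := r im (jm im) in imP.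
have rho0 : 0 < rho.
  have [j Fj Wj] := Wpos _ Fim; apply: lt_le_trans (jmP im j Fj).
  by rewrite divr_gt0// dpos.
pose b := if io im then jm im else im.
have iob : ~~ io b.
  rewrite /b; case: ifPn => // ioim; apply/negP => iojm.
  by move: rho0; rewrite /rho /r !Wio// addr0 mul0r ltxx.
pose Wb h := if h == b then W' h else W h.
pose rb j := (Wb im + Wb j) / (L im - L j) ^+ 2.
have rb_lt j : ~~ F j -> rb j < rho.
  (* For frozen [im], the smaller variance of [im] lowers its ratio against every opponent. *)
  move=> Fj; have [ioim|ioim] := boolP (io im); last first.
    apply: lt_le_trans (jmP _ _ Fj); rewrite /rb /r /Wb /b (negbTE ioim) eqxx.
    rewrite neqF// ltr_pM2r ?invr_gt0 ?dpos// ltrD2r.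
    by have /andP[] := WW' _ ioim.
  have bE : b = jm im by rewrite /b ioim.
  have imb : (im == b) = false by rewrite bE eq_sym neqF.
  have [jb|jb] := eqVneq j b.
    rewrite /rb /Wb jb eqxx imb /rho /r -bE ltr_pM2r ?invr_gt0; last first.
      by rewrite dpos// bE.
    by rewrite ltrD2l; have /andP[] := WW' _ iob.
  (* An opponent other than [b] keeps its ratio, which must be strictly below [rho]: it is 0 for an
     opponent sampled infinitely often, and [notie] excludes equality for a frozen one. *)
  rewrite /rb /Wb imb (negbTE jb) -/(r im j) lt_neqAle jmP// andbT.
  have [ioj|ioj] := boolP (io j).
    by rewrite {1}/r !Wio// addr0 mul0r lt_eqF.
  rewrite /rho /r Wio// !add0r; apply: notie => //.
    by rewrite -bE.
  by rewrite -bE.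
pose jb := [arg max_(j > j0 | ~~ F j) rb j]%O.
have Fjb : ~~ F jb by rewrite /jb; case: arg_maxP.
have jbP j : ~~ F j -> rb j <= rb jb.
  by rewrite /jb; case: arg_maxP => // j' _ + Fj; exact.
have Wb0 h : 0 <= Wb h.
  rewrite /Wb; case: eqP => // ->; by have /andP[] := WW' _ iob.
have rbjb0 : 0 <= rb jb by rewrite divr_ge0 ?addr_ge0 ?sqr_ge0.
have := rb_lt _ Fjb => rbjb.
(* The midpoint separates the largest ratio of [im] after sampling [b] from [rho]. *)
exists b, ((rb jb + rho) / 2); split => //.
- by rewrite divr_gt0// ltr_wpDl.
- move=> i Fi; exists (jm i); first exact: Fjm.
  rewrite -ltr_pdivlMr ?dpos//; apply: lt_le_trans (imP _ Fi).
  by rewrite midf_lt.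
- exists im => // j Fj; rewrite -ltr_pdivrMr ?dpos//.
  by apply: le_lt_trans (jbP _ Fj) _; rewrite midf_lt.
Qed.

Lemma cvg_lt_near (R : realType) (f g : nat -> R) (p q : R) :
  f @ \oo --> p -> g @ \oo --> q -> p < q -> \forall t \near \oo, f t < g t.
Proof.
move=> fp gq pq; near=> t; rewrite -subr_gt0; near: t.
apply: (cvgr_gt (q - p)); last by rewrite subr_gt0.
exact: cvgB.
Unshelve. all: by end_near. Qed.

(** * Stability of the top set *)

Section ranking.
Context (R : realType) (k m : nat).
Implicit Types L M : 'I_k -> R.

(** Whatever is ranked ahead of [j] is also ahead of [i], so [j] has no more predecessors than
    [i]. *)
Lemma in_top_upward L i j : in_top m L i -> L i < L j -> in_top m L j.
Proof.
rewrite /in_top => Fi Lij; apply: leq_ltn_trans Fi; apply: subset_leq_card.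
apply/fintype.subsetP => l; rewrite !inE => /orP[jl|/andP[/eqP-> _]].
  by rewrite (lt_trans Lij jl).
by rewrite Lij.
Qed.

Lemma in_top_max L (j0 : 'I_k) : injective L -> (0 < m)%N ->
  exists i, in_top m L i.
Proof.
move=> injL m0; exists [arg max_(i > j0) L i]%O.
case: arg_maxP => // i _ iP; rewrite /in_top eq_card0// => j; rewrite !inE.
have /negbTE -> : ~~ (L i < L j) by rewrite -leNgt; exact: iP.
by apply/negP => /andP[/eqP/injL ->]; rewrite ltnn.
Qed.

(** As the limits are distinct, each of the finitely many pairwise comparisons eventually agrees
    with that of the limits. *)
Lemma in_top_cvg L (M : nat -> 'I_k -> R) : injective L ->
  (forall h, M ^~ h @ \oo --> L h) ->
  \forall t \near \oo, forall h, in_top m (M t) h = in_top m L h.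
Proof.
move=> injL ML.
have lt_near h j : L h < L j -> \forall t \near \oo, M t h < M t j.
  exact: cvg_lt_near.
have cmp h j : \forall t \near \oo,
    ((M t h < M t j) || ((M t j == M t h) && ltn j h)) =
    ((L h < L j) || ((L j == L h) && ltn j h)).
  have [->|jh] := eqVneq j h.
    by near=> t; rewrite !ltxx !eqxx.
  have [hj|jh'|/injL e] := ltgtP (L h) (L j).
  - by near=> t; rewrite (near (lt_near _ _ hj) t).
  - near=> t; have Mjh : M t j < M t h by near: t; exact: lt_near.
    by rewrite ltNge (ltW Mjh)/= (lt_eqF Mjh).
  - by rewrite e eqxx in jh.
have cmp' : \forall t \near \oo, forall h j,
    ((M t h < M t j) || ((M t j == M t h) && ltn j h)) =
    ((L h < L j) || ((L j == L h) && ltn j h)).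
  by apply: filter_forall => h; apply: filter_forall => j.
near=> t => h; rewrite /in_top; congr (_ < m)%N; apply: eq_card => j.
by rewrite !inE; move: h j; near: t.
Unshelve. all: by end_near. Qed.

End ranking.

(** * Counts, posterior limits and the greedy choice *)

Section sampling.
Context (R : realType) (k m n0 : nat).
Variables (mu mu0 sig sig0 : 'I_k -> R).
Variable pick : nat -> ('I_k -> nat) -> ('I_k -> R) -> 'I_k.
Variable x : 'I_k -> nat -> R.

Hypothesis m_gt0 : (0 < m)%N.
Hypothesis n0_gt0 : (0 < n0)%N.
Hypothesis sig_gt0 : forall h, 0 < sig h.
Hypothesis sig0_gt0 : forall h, 0 < sig0 h.

Local Notation pvar := (post_var sig sig0).

Lemma post_var_gt0 h n : 0 < pvar h n.
Proof.
by rewrite invr_gt0 ltr_wpDr ?divr_ge0 ?sqr_ge0// invr_gt0 exprn_gt0.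
Qed.

Lemma post_varS_lt h n : pvar h n.+1 < pvar h n.
Proof.
have Q0 l : 0 < (sig0 h ^+ 2)^-1 + l%:R / sig h ^+ 2.
  by rewrite -invr_gt0; exact: (post_var_gt0 h l).
rewrite /post_var ltf_pV2 ?posrE ?Q0// ltrD2l ltr_pM2r ?ltr_nat//.
by rewrite invr_gt0 exprn_gt0.
Qed.

Lemma cvg_post_var h : pvar h n @[n --> \oo] --> 0.
Proof.
pose u n : R := (sig0 h ^+ 2)^-1 + n%:R / sig h ^+ 2.
apply/(@gtr0_cvgV0 _ _ _ _ u).
  by apply: nearW => n; rewrite -invr_gt0; exact: post_var_gt0.
apply/cvgryPge => A; near=> n.
apply: (@le_trans _ _ (n%:R / sig h ^+ 2)); last first.
  by rewrite lerDr invr_ge0 sqr_ge0.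
rewrite ler_pdivlMr ?exprn_gt0//; near: n.
exact: (cvgryPge _).1 (@cvgr_idn R) _.
Unshelve. all: by end_near. Qed.

(* [post_mean] at [h] reads only the count and the sum of [h], whence the
   constant count function. *)
Definition pmean h n := post_mean mu0 sig sig0 (fun=> n) (sums x (fun=> n)) h.

Let c t := counts n0 pick x t.
Let a t := pick t (c t) (sums x (c t)).

Lemma countsS t h : c t.+1 h = (c t h + (h == a t))%N. Proof. by []. Qed.

Lemma counts_mono h : {homo c^~ h : t u / (t <= u)%N}.
Proof.
apply: homo_leq => [//|? ? ?|t]; first exact: leq_trans.
by rewrite countsS leq_addr.
Qed.

Lemma counts_gt0 t h : (0 < c t h)%N.
Proof. by apply: leq_trans (counts_mono h (leq0n t)). Qed.

(** Each step adds at most one sample, so an unbounded count means sampling infinitely often. *)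
Let io h : bool := `[< forall N, exists t, (N <= c t h)%N >].

Lemma counts_io h : io h -> c t h @[t --> \oo] --> \oo.
Proof.
move=> /asboolP ioh; apply/cvgnyPge => N.
have [t tN] := ioh N; exists t => // u /= tu.
exact: leq_trans tN (counts_mono h tu).
Qed.

(** A bounded nondecreasing count is constant once it reaches its maximum; any later draw of [h]
    would exceed it. *)
Lemma counts_frozen h : ~~ io h ->
  exists N, \forall t \near \oo, c t h = N /\ h != a t.
Proof.
move=> /asboolP/existsNP[B nB].
have cB t : (c t h <= B)%N.
  by rewrite leqNgt; apply/negP => Bt; apply: nB; exists t; exact: ltnW.
have ex : exists n, `[< exists t, c t h = n >].
  by exists n0; apply/asboolP; exists 0%N.
have ubd n : `[< exists t, c t h = n >] -> (n <= B)%N.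
  by move=> /asboolP[t <-].
have [N /asboolP[t tN] NP] := ex_maxnP ex ubd.
have const u : (t <= u)%N -> c u h = N.
  move=> tu; apply/eqP; rewrite eqn_leq -{2}tN counts_mono// andbT.
  by apply: NP; apply/asboolP; exists u.
exists N; exists t => // u /= tu; split; first exact: const.
apply/negP => ha; have := countsS u h; rewrite ha !const//; last exact: leqW.
by move/eqP; rewrite addn1 eqn_leq ltnn andbF.
Qed.

(** For a max-min, an upper bound needs one bad opponent for each top [i]; the lower bound in
    [Vhat_gt] needs one top [i] good against all opponents. The threshold [q] bounds inverted
    ratios, whence [q^-1]. *)
Lemma Vhat_lt (C : 'I_k -> nat) (S : 'I_k -> R) b q :
  let M := post_mean mu0 sig sig0 C S in
  (forall i, in_top m M i -> exists2 j, ~~ in_top m M j &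
     q * (M i - M j) ^+ 2 < s2 sig sig0 C b i + s2 sig sig0 C b j) -> 0 < q ->
  (Vhat mu0 sig sig0 m C S b < q^-1%:E)%E.
Proof.
move=> M H q0; apply: bigmax_lt; first exact: ltNyr.
move=> i Fi; have [j Fj ij] := H i Fi.
apply: le_lt_trans; first by apply: bigmin_le_cond; exact: Fj.
have w0 : 0 < s2 sig sig0 C b i + s2 sig sig0 C b j.
  by rewrite addr_gt0// post_var_gt0.
by rewrite lte_fin ltr_pdivrMr// mulrC ltr_pdivlMr// mulrC.
Qed.

Lemma Vhat_gt (C : 'I_k -> nat) (S : 'I_k -> R) b q :
  let M := post_mean mu0 sig sig0 C S in
  (exists2 i, in_top m M i & forall j, ~~ in_top m M j ->
     s2 sig sig0 C b i + s2 sig sig0 C b j < q * (M i - M j) ^+ 2) -> 0 < q ->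
  (q^-1%:E < Vhat mu0 sig sig0 m C S b)%E.
Proof.
move=> M [i Fi H] q0.
apply: lt_le_trans; last by apply: le_bigmax_cond; exact: Fi.
apply: lt_bigmin; first exact: ltry.
move=> j Fj; have ij := H j Fj.
have w0 : 0 < s2 sig sig0 C b i + s2 sig sig0 C b j.
  by rewrite addr_gt0// post_var_gt0.
by rewrite lte_fin ltr_pdivlMr// mulrC ltr_pdivrMr// mulrC.
Qed.

Hypothesis mu_inj : injective mu.
Hypothesis greedy : forall s C S b,
  (Vhat mu0 sig sig0 m C S b <= Vhat mu0 sig sig0 m C S (pick s C S))%E.
Hypothesis mean_cvg : forall h, pmean h n @[n --> \oo] --> mu h.
Hypothesis mean_neq : forall h h' n n', h != h' -> (0 < n)%N -> (0 < n')%N ->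
  pmean h n != pmean h' n'.
Hypothesis mean_neq_mu : forall h h' n, h != h' -> (0 < n)%N ->
  pmean h n != mu h'.
Hypothesis rate_neq : forall i j j' n n', i != j -> i != j' -> j != j' ->
  (0 < n)%N -> (0 < n')%N ->
  pvar j n / (mu i - pmean j n) ^+ 2 != pvar j' n' / (mu i - pmean j' n') ^+ 2.

(** A pathwise statement: convergence of the means and absence of ties among limits and rates are
    hypotheses, to be verified almost surely later. *)
Lemma best_eventually_in_top best :
  (forall h, h != best -> mu h < mu best) ->
  \forall t \near \oo, in_top m (post_mean mu0 sig sig0 (c t) (sums x (c t))) best.
Proof.
move=> bestP.
(* [N h] is the final count of a frozen [h]; the value 0 for the others is a dummy. *)
have /choice[N NP] : forall h, exists N, ~~ io h ->
    \forall t \near \oo, c t h = N /\ h != a t.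
  move=> h; have [ioh|/counts_frozen[N NP]] := boolP (io h); first by exists 0%N.
  by exists N.
have N0 h : ~~ io h -> (0 < N h)%N.
  move=> /NP[t _ /(_ t (leqnn t))[<- _]]; exact: counts_gt0.
pose L h := if io h then mu h else pmean h (N h).
pose W h := if io h then 0 else pvar h (N h).
pose W' h := if io h then 0 else pvar h (N h).+1.
pose M t h := pmean h (c t h).
have injL : injective L.
  move=> h h' LL; apply/eqP; apply: contra_eqT LL => hh'.
  rewrite /L; case: ifPn => ioh; case: ifPn => ioh'.
  - by rewrite (inj_eq mu_inj).
  - by rewrite eq_sym mean_neq_mu ?N0// eq_sym.
  - by rewrite mean_neq_mu ?N0.
  - by rewrite mean_neq ?N0.
have ML h : M ^~ h @ \oo --> L h.
  rewrite /L; case: ifPn => ioh.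
    exact: cvg_comp (counts_io ioh) (@mean_cvg h).
  apply: cvg_near_cst; near=> t; rewrite /M.
  by have [//|-> _] := near (NP _ ioh) t.
have s2cvg b h : s2 sig sig0 (c t) b h @[t --> \oo] --> (if h == b then W' h else W h).
  rewrite /s2 /W /W'; have [ioh|ioh] := boolP (io h).
    rewrite if_same; apply: cvg_comp (@cvg_post_var h).
    apply/cvgnyPge => A; near=> t; apply: leq_trans (leq_addr _ _).
    by near: t; exact: (cvgnyPge _).1 (counts_io ioh) A.
  rewrite (_ : (if _ then _ else _) = pvar h (N h + (h == b))); last first.
    by case: ifP; rewrite ?addn1 ?addn0.
  apply: cvg_near_cst; near=> t.
  by have [//|-> _] := near (NP _ ioh) t.
have [Fbest|Gbest] := boolP (in_top m L best).
  have := in_top_cvg m injL (@ML); apply: filterS => t /(_ best).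
  by rewrite Fbest; exact.
exfalso.
have W_ge0 h : 0 <= W h by rewrite /W; case: ifP => // _; exact/ltW/post_var_gt0.
have W_gt0 h : ~~ io h -> 0 < W h by rewrite /W => /negbTE ->; exact: post_var_gt0.
have [i0 Fi0] := in_top_max best injL m_gt0.
have [] := @improving_candidate R _ (in_top m L) io L W W' i0 best Fi0 Gbest.
- by move=> h; rewrite /W => ->.
- move=> h; rewrite /W /W' => /negbTE ->.
  by rewrite ltW ?post_var_gt0// post_varS_lt.
- exact: W_ge0.
- by move=> i j Fi; apply: contraNneq => /injL <-.
(* The opponent is [best]: were both limiting variances 0, both limiting means would be true means,
   and [best] would outrank the top alternative [i]. *)
- move=> i Fi; exists best => //.
  have [ioi|ioi] := boolP (io i); last by rewrite ltr_pwDl// W_gt0.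
  have [iob|iob] := boolP (io best); last by rewrite ltr_wpDl// W_gt0.
  have /negP[] := Gbest; apply: (in_top_upward Fi); rewrite /L ioi iob bestP//.
  by apply/eqP => e; move: Gbest; rewrite -e Fi.
- move=> i j j' Fi Gj Gj' ioi ioj ioj' jj'.
  rewrite /W /L ioi (negbTE ioj) (negbTE ioj'); apply: rate_neq; rewrite ?N0//.
    by apply/eqP => e; move: Gj; rewrite -e Fi.
  by apply/eqP => e; move: Gj'; rewrite -e Fi.
move=> b [q [iob q0 small [i1 Fi1 big]]].
(* Past the last draw of every frozen alternative, only those sampled infinitely often are
   chosen. *)
have neverb : \forall t \near \oo, io (a t).
  have frozen : \forall t \near \oo, forall h, ~~ io h -> h != a t.
    apply: filter_forall => h; have [ioh|ioh] := boolP (io h).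
      exact: nearW.
    by apply: filterS (NP h ioh) => t [_ ha] _.
  apply: filterS frozen => t /(_ (a t)); rewrite eqxx.
  by have [//|_ /(_ isT)] := boolP (io (a t)).
have s2D b' i j : s2 sig sig0 (c t) b' i + s2 sig sig0 (c t) b' j @[t --> \oo] -->
    (if i == b' then W' i else W i) + (if j == b' then W' j else W j).
  by apply: cvgD; exact: s2cvg.
have qM i j : q * (M t i - M t j) ^+ 2 @[t --> \oo] --> q * (L i - L j) ^+ 2.
  apply: cvgM; first exact: cvg_cst.
  by rewrite expr2; apply: cvgM; apply: cvgB; exact: ML.
have Wio b' h : io b' -> (if h == b' then W' h else W h) = W h.
  by case: eqP => // -> iob'; rewrite /W /W' iob'.
(* Candidates sampled infinitely often leave the limiting variances unchanged, so their values stay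
   below [q^-1]; by [lower], that of [b] exceeds [q^-1]. This contradicts [greedy]. *)
have upper : \forall t \near \oo, forall b' i, io b' -> in_top m L i ->
    exists2 j, ~~ in_top m L j &
    q * (M t i - M t j) ^+ 2 < s2 sig sig0 (c t) b' i + s2 sig sig0 (c t) b' j.
  apply: filter_forall => b'; apply: filter_forall => i.
  have [iob'|niob'] := boolP (io b'); last exact: nearW.
  have [Fi|nFi] := boolP (in_top m L i); last exact: nearW.
  have [j Gj ij] := small i Fi.
  have ij' : q * (L i - L j) ^+ 2 <
      (if i == b' then W' i else W i) + (if j == b' then W' j else W j).
    by rewrite !Wio.
  by apply: filterS (cvg_lt_near (qM i j) (s2D b' i j) ij') => t ? _ _; exists j.
have lower : \forall t \near \oo, forall j, ~~ in_top m L j ->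
    s2 sig sig0 (c t) b i1 + s2 sig sig0 (c t) b j < q * (M t i1 - M t j) ^+ 2.
  apply: filter_forall => j; have [Fj|Gj] := boolP (in_top m L j).
    exact: nearW.
  by apply: filterS (cvg_lt_near (s2D b i1 j) (qM i1 j) (big j Gj)) => t ? _.
have order := in_top_cvg m injL (@ML).
have : \forall t \near \oo, False.
  near=> t.
  have tF : forall h, in_top m (M t) h = in_top m L h by near: t.
  have := greedy t (c t) (sums x (c t)) b; apply/negP; rewrite -ltNge.
  have Vlt : (Vhat mu0 sig sig0 m (c t) (sums x (c t)) (a t) < q^-1%:E)%E.
    apply: Vhat_lt => // i; rewrite tF => Fi.
    have up : forall b' i, io b' -> in_top m L i -> exists2 j, ~~ in_top m L j &
      q * (M t i - M t j) ^+ 2 < s2 sig sig0 (c t) b' i + s2 sig sig0 (c t) b' j.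
      by near: t.
    have ioa : io (a t) by near: t.
    by have [j Gj ij] := up _ _ ioa Fi; exists j; rewrite ?tF.
  apply: lt_trans Vlt _; apply: Vhat_gt => //; exists i1; first by rewrite tF.
  by move=> j; rewrite tF; move: j; near: t.
by move=> [t _ /(_ t (leqnn t))].
Unshelve. all: by end_near. Qed.

End sampling.

(** * Almost sure properties of the posterior means *)

(** Solving the forbidden equation for the first sample of [h] leaves a function [Y] of other
    samples, which an independent atomless variable almost surely avoids. *)
Lemma sums_neq_affine d (T : measurableType d) (R : realType)
    (P : probability T R) (k : nat) (X : 'I_k -> nat -> T -> R)
    (h h' : 'I_k) (n n' : nat) (m s b e : R) :
  (forall h n, measurable_fun setT (X h n)) ->
  mutually_independent P (fun p : 'I_k * nat => X p.1 p.2) ->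
  (forall B, measurable B -> P (X h 0 @^-1` B) = normal_prob m s B) ->
  h != h' -> (0 < n)%N ->
  {ae P, forall w, \sum_(i < n) X h i w != b * (\sum_(i < n') X h' i w) + e}.
Proof.
move=> mX indX lawX hh'; case: n => // n _.
pose Z (p : 'I_k * nat) := X p.1 p.2.
(* The remaining samples of [h], from index 1 on, and all those of [h'] in the sum. *)
pose J := [seq (h, i) | i <- iota 1 n] ++ [seq (h', i) | i <- iota 0 n'].
have mZ p : measurable_fun setT (Z p) by exact: mX.
have uJ : uniq J.
  rewrite cat_uniq !map_inj_uniq ?iota_uniq//=; last 2 first.
  - by move=> ? ? [].
  - by move=> ? ? [].
  rewrite andbT; apply/hasPn => _ /mapP[i _ ->]; apply/negP => /mapP[j _ [e' _]].
  by rewrite e' eqxx in hh'.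
have pJ : (h, 0%N) \notin J.
  rewrite mem_cat negb_or; apply/andP; split; apply/negP => /mapP[i].
    by rewrite mem_iota => /andP[+ _] [i0]; rewrite -i0.
  by move=> _ [e' _]; rewrite e' eqxx in hh'.
pose Y w := b * (\sum_(i < n') X h' i w) + e - \sum_(i < n) X h i.+1 w.
have mY : measurable_fun [set: g_sigma_algebraType (cylinders Z J)] Y.
  apply: measurable_funB.
    apply: measurable_funD => //; apply: measurable_funM => //.
    apply: measurable_sum => i; apply: (@measurable_cylinder_coord _ _ _ _ Z J (h', i : nat)).
    by rewrite mem_cat; apply/orP; right; rewrite map_f// mem_iota/=.
  apply: measurable_sum => i; apply: (@measurable_cylinder_coord _ _ _ _ Z J (h, i.+1)).
  rewrite mem_cat; apply/orP; left; rewrite map_f// mem_iota/= add1n ltnS.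
  exact: ltn_ord.
apply: filterS (normal_neq_independent mZ indX uJ pJ lawX mY) => w.
apply: contra_neq; rewrite big_ord_recl /Y /Z/= => <-.
by rewrite addrK.
Qed.

Lemma ae_imp d (T : measurableType d) (R : realType)
    (P : {measure set T -> \bar R}) (Q : Prop) (F : T -> Prop) :
  (Q -> {ae P, forall w, F w}) -> {ae P, forall w, Q -> F w}.
Proof.
have [q /(_ q)|nq _] := pselect Q; last exact: aeW.
by apply: filterS => w.
Qed.

(** A tie between the squared ratios splits into two linear relations, one for each sign of the
    square root. *)
Lemma ratio_sqr_neq (R : rcfType) (p p' u u' : R) :
  0 < p -> 0 < p' -> u != 0 -> u' != 0 ->
  u != Num.sqrt (p / p') * u' -> u != - Num.sqrt (p / p') * u' ->
  p / u ^+ 2 != p' / u' ^+ 2.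
Proof.
move=> p0 p'0 u0 u'0 uu' uNu'; apply/eqP => e.
have : u ^+ 2 == (Num.sqrt (p / p') * u') ^+ 2.
  rewrite exprMn sqr_sqrtr ?divr_ge0 ?ltW//; apply/eqP.
  have -> : p = p' / u' ^+ 2 * u ^+ 2 by rewrite -e divfK// expf_neq0.
  by field; rewrite u'0 gt_eqF.
by rewrite eqf_sqr -mulNr (negbTE uu') (negbTE uNu').
Qed.

(** The posterior mean is a convex combination of prior mean and sample mean, and the prior's weight
    [post_var * q] tends to 0. *)
Lemma cvg_pmean (R : realType) (k : nat) (mu0 sig sig0 : 'I_k -> R)
    (x : 'I_k -> nat -> R) (h : 'I_k) (l : R) :
  (forall h, 0 < sig h) -> (forall h, 0 < sig0 h) ->
  (\sum_(i < n) x h i) / n%:R @[n --> \oo] --> l ->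
  pmean mu0 sig sig0 x h n @[n --> \oo] --> l.
Proof.
move=> sig_gt0 sig0_gt0 xl; pose q := (sig0 h ^+ 2)^-1.
have pv := @cvg_post_var _ _ _ _ sig_gt0 sig0_gt0 h.
(* [post_var n * (q + n / sig^2) = 1] *)
pose f n := post_var sig sig0 h n * (mu0 h * q) +
  (\sum_(i < n) x h i) / n%:R * (1 - post_var sig sig0 h n * q).
have fl : f n @[n --> \oo] --> l.
  rewrite -[l]add0r -[X in 0 + X]mulr1 -[X in X + _](mul0r (mu0 h * q)).
  rewrite -[X in l * X](subr0 1) -[X in 1 - X](mul0r q).
  apply: cvgD; first by apply: cvgM => //; exact: cvg_cst.
  apply: cvgM => //; apply: cvgB; first exact: cvg_cst.
  by apply: cvgM => //; exact: cvg_cst.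
apply: cvg_trans fl; apply: near_eq_cvg; near=> n.
have n0 : (0 < n)%N by near: n; exact: nbhs_infty_gt.
have p0 : 0 < post_var sig sig0 h n by exact: post_var_gt0.
have pE : 1 - post_var sig sig0 h n * q =
    post_var sig sig0 h n * (n%:R / sig h ^+ 2).
  rewrite -{1}(mulfV (lt0r_neq0 p0)) -mulrBr; congr (_ * _).
  by rewrite /post_var invrK /q addrAC subrr add0r.
rewrite /f pE /pmean /post_mean /sums -/q.
by field; rewrite pnatr_eq0 -lt0n n0 andbT gt_eqF.
Unshelve. all: by end_near. Qed.

Lemma pmean_neq_affine d (T : measurableType d) (R : realType)
    (P : probability T R) (k : nat) (X : 'I_k -> nat -> T -> R)
    (mu0 sig sig0 : 'I_k -> R) (h h' : 'I_k) (n n' : nat) (m s b e : R) :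
  (forall h, 0 < sig h) -> (forall h, 0 < sig0 h) ->
  (forall h n, measurable_fun setT (X h n)) ->
  mutually_independent P (fun p : 'I_k * nat => X p.1 p.2) ->
  (forall B, measurable B -> P (X h 0 @^-1` B) = normal_prob m s B) ->
  h != h' -> (0 < n)%N ->
  {ae P, forall w, let M := pmean mu0 sig sig0 (fun h n => X h n w) in
    M h n != b * M h' n' + e}.
Proof.
move=> sig_gt0 sig0_gt0 mX indX lawX hh' n_gt0.
set A := post_var sig sig0 h n; set A' := post_var sig sig0 h' n'.
have A0 : A != 0 by rewrite gt_eqF// post_var_gt0.
set Q := mu0 h / sig0 h ^+ 2; set Q' := mu0 h' / sig0 h' ^+ 2.
have v0 : sig h ^+ 2 != 0 by rewrite gt_eqF ?exprn_gt0.
(* The coefficients come from solving A (Q + S / sig h ^+ 2) = b A' (Q' + S' / sig h' ^+ 2) + e for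
   S. *)
have := @sums_neq_affine _ _ _ P _ X h h' n n' m s
  (sig h ^+ 2 * b * A' / A / sig h' ^+ 2)
  (sig h ^+ 2 * ((b * A' * Q' + e) / A - Q)) mX indX lawX hh' n_gt0.
apply: filterS => w /=; apply: contra_neq.
rewrite /pmean /post_mean /sums -/A -/A' -/Q -/Q'.
set S := \sum_(i < n) _; set S' := \sum_(i < n') _ => eqM.
have -> : S = sig h ^+ 2 * (A * (Q + S / sig h ^+ 2) / A - Q).
  by field; rewrite A0 expf_eq0/= in v0 *.
rewrite eqM; ring.
Qed.

Theorem theorem1 (R : realType) (d : measure_display) (T : measurableType d)
    (P : probability T R) (k m n0 : nat)
    (mu mu0 sig sig0 : 'I_k -> R) (best : 'I_k)
    (X : 'I_k -> nat -> T -> R)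
    (pick : nat -> ('I_k -> nat) -> ('I_k -> R) -> 'I_k) :
  (2 <= k)%N -> (1 <= m)%N -> (m < k)%N -> (1 <= n0)%N ->
  (forall h, 0 < sig h) -> (forall h, 0 < sig0 h) ->
  (forall h h', h != h' -> mu h != mu h') ->
  (forall h, h != best -> mu h < mu best) ->
  (forall h n, measurable_fun setT (X h n)) ->
  (forall h n (B : set R), measurable B ->
     P (X h n @^-1` B) = normal_prob (mu h) (sig h) B) ->
  mutually_independent P (fun p : 'I_k * nat => X p.1 p.2) ->
  (forall s (c : 'I_k -> nat) (S : 'I_k -> R) (a : 'I_k),
     (Vhat mu0 sig sig0 m c S a <= Vhat mu0 sig sig0 m c S (pick s c S))%E) ->
  {ae P, forall w, exists t0, forall t, (t0 <= t)%N ->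
     let c := counts n0 pick (fun h n => X h n w) t in
     in_top m (post_mean mu0 sig sig0 c (sums (fun h n => X h n w) c)) best}.
Proof.
move=> _ m0 _ n0_gt0 sig_gt0 sig0_gt0 mu_neq bestP mX lawX indX greedy.
have mu_inj : injective mu.
  by move=> h h'; apply: contra_eq => /mu_neq.
pose M w := pmean mu0 sig sig0 (fun h n => X h n w).
have M_neq h h' n n' b e : h != h' -> (0 < n)%N ->
    {ae P, forall w, M w h n != b * M w h' n' + e}.
  by move=> hh' n_gt0; apply: pmean_neq_affine (lawX h 0%N) hh' n_gt0.
have cvgM : {ae P, forall w, forall h, M w h n @[n --> \oo] --> mu h}.
  apply: filter_forall => h.
  have hinj : injective (fun n : nat => (h, n)) by move=> ? ? [].
  have := strong_law_normal (fun p => mX p.1 p.2) indX hinj (sig_gt0 h) (lawX h).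
  by apply: filterS => w; exact: cvg_pmean.
have neq1 : {ae P, forall w, forall h h' n n', h != h' -> (0 < n)%N ->
    M w h n != M w h' n'}.
  apply: filter_forall => h; apply: filter_forall => h'.
  apply: ae_foralln => n; apply: ae_foralln => n'.
  apply: ae_imp => hh'; apply: ae_imp => n_gt0.
  by apply: filterS (M_neq h h' n n' 1 0 hh' n_gt0) => w; rewrite mul1r addr0.
have neq2 : {ae P, forall w, forall h h' n, h != h' -> (0 < n)%N ->
    M w h n != mu h'}.
  apply: filter_forall => h; apply: filter_forall => h'; apply: ae_foralln => n.
  apply: ae_imp => hh'; apply: ae_imp => n_gt0.
  (* Slope 0 turns the affine relation into comparison with the constant [mu h']; the count 0 is
     arbitrary. *)
  by apply: filterS (M_neq h h' n 0%N 0 (mu h') hh' n_gt0) => w;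
    rewrite mul0r add0r.
have neq3 (b : nat -> nat -> 'I_k -> 'I_k -> R) : {ae P, forall w,
    forall i j j' n n', j != j' -> (0 < n)%N ->
    mu i - M w j n != b n n' j j' * (mu i - M w j' n')}.
  apply: filter_forall => i; apply: filter_forall => j; apply: filter_forall => j'.
  apply: ae_foralln => n; apply: ae_foralln => n'.
  apply: ae_imp => hh'; apply: ae_imp => n_gt0.
  (* Equality of the differences up to the factor [b] means M j = b M j' + (1 - b) mu i. *)
  have := M_neq j j' n n' (b n n' j j') ((1 - b n n' j j') * mu i) hh' n_gt0.
  apply: filterS => w; apply: contra_neq => e.
  by rewrite -[LHS](subKr (mu i)) e; ring.
pose b n n' j j' := Num.sqrt (post_var sig sig0 j n / post_var sig sig0 j' n').
have rates : {ae P, forall w, forall i j j' n n', i != j -> i != j' -> j != j' ->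
    (0 < n)%N -> (0 < n')%N ->
    post_var sig sig0 j n / (mu i - M w j n) ^+ 2 !=
    post_var sig sig0 j' n' / (mu i - M w j' n') ^+ 2}.
  apply: filterS3 neq2 (neq3 b) (neq3 (fun n n' j j' => - b n n' j j')).
  move=> w n2 n3p n3m i j j' n n' ij ij' jj' n_gt0 n'_gt0.
  apply: ratio_sqr_neq; rewrite ?post_var_gt0//.
  - by rewrite subr_eq0 eq_sym; apply: n2; rewrite // eq_sym.
  - by rewrite subr_eq0 eq_sym; apply: n2; rewrite // eq_sym.
  - exact: n3p.
  - exact: n3m.
have neq12 : {ae P, forall w,
    (forall h h' n n', h != h' -> (0 < n)%N -> M w h n != M w h' n') /\
    (forall h h' n, h != h' -> (0 < n)%N -> M w h n != mu h')}.
  exact: filterS2 neq1 neq2.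
apply: filterS3 cvgM neq12 rates => w cvgw [n1 n2] ratesw.
have [] := @best_eventually_in_top R k m n0 mu mu0 sig sig0 pick
    (fun h n => X h n w) m0 n0_gt0 sig_gt0 sig0_gt0 mu_inj greedy cvgw
    (fun h h' n n' hh' n_gt0 _ => n1 h h' n n' hh' n_gt0) n2 ratesw best bestP.
by move=> t0 _ H; exists t0.
Qed.
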